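(* Let $\mathcal D_q(m|n)\subseteq\mathrm{End}_\Bbbk(\Omega_q(m|n))$ be the associative $\Bbbk$-superalgebra generated by the $q$-derivations $\partial_i$ $(i\in I)$ of the quantum Grassmann superalgebra $\Omega_q(m|n)$, with $\mathcal D_q(m|n)=\mathcal D_q(m|n)_{\bar0}\oplus\mathcal D_q(m|n)_{\bar1}$ graded by the generator parity $|\partial_i|=\bar1$ exactly for $i\in I_1$. Then $\mathcal D_q(m|n)$ is isomorphic to the quantum affine $(m|n)$-superspace $A_q^{m|n}$.
   Context: $\Bbbk$ is an algebraically closed field of characteristic zero, $q\in\Bbbk^\times$, $q\ne1$; $m,n\ge0$ are integers, $I_0=\{1,\dots,m\}$, $I_1=\{m+1,\dots,m+n\}$, $I=I_0\cup I_1$. $q$-binomials ${s\brack r}=\prod_{i=1}^r\frac{v^{s-i+1}-v^{-s+i-1}}{v^i-v^{-i}}\in\mathbb Z[v,v^{-1}]$ are evaluated at $v=q$. For $a,b\in\mathbb Z^{m+n}$ put $a*b=\sum_{i>j}a_ib_j$; $\epsilon_i$ are the standard basis vectors. Regard $\alpha\in\mathbb Z^m$ as supported on $I_0$ and $\mu=(\mu_{m+1},\dots,\mu_{m+n})\in\{0,1\}^n$ as supported on $I_1$. The quantum affine $(m|n)$-superspace $A_q^{m|n}$ is the quotient of the free associative algebra $\Bbbk\{v_i\mid i\in I\}$ by the ideal generated by $v_jv_i-qv_iv_j$ for $i\in I_0$, $j\in I$, $j>i$; and $v_i^2$, $v_jv_i+qv_iv_j$ for $i,j\in I_1$, $j>i$.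 It is a superalgebra with $v_i$ even for $i\in I_0$, odd for $i\in I_1$. $\Omega_q(m|n)$ is the algebra with basis $x^{(\alpha)}\otimes x^\mu$, $\alpha\in\mathbb Z_{\ge0}^m$, $\mu\in\{0,1\}^n$, and multiplication $(x^{(\alpha)}\otimes x^\mu)(x^{(\beta)}\otimes x^\nu)=q^{\mu*\beta}x^{(\alpha)}x^{(\beta)}\otimes x^\mu x^\nu$, where $x^{(\alpha)}x^{(\beta)}=q^{\alpha*\beta}\prod_{i=1}^m{\alpha_i+\beta_i\brack\alpha_i}x^{(\alpha+\beta)}$ and $x^\mu x^\nu=(-q)^{\mu*\nu}x^{\mu+\nu}$ (zero if $\mu+\nu\notin\{0,1\}^n$). The $q$-derivations are: $\partial_i(x^{(\alpha)}\otimes x^\mu)=q^{-\epsilon_i*\alpha}x^{(\alpha-\epsilon_i)}\otimes x^\mu$ for $i\in I_0$ (zero if $\alpha_i=0$); $\partial_i(x^{(\alpha)}\otimes x^\mu)=q^{-\epsilon_i*\alpha}(-q)^{-\epsilon_i*\mu}\delta_{1,\mu_i}\,x^{(\alpha)}\otimes x^{\mu-\epsilon_i}$ for $i\in I_1$. *)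

(* Defs.v *)
From HB Require Import structures.
From mathcomp Require Import all_boot all_algebra.
From mathcomp Require Import boolp.
From mathcomp Require Import finmap.
From mathcomp.multinomials Require Import monalg.

Set Implicit Arguments.
Unset Strict Implicit.
Unset Printing Implicit Defensive.

Import GRing.Theory.
Local Open Scope ring_scope.
Local Open Scope quotient_scope.

Definition endo (K : comNzRingType) (V : lmodType K) := {linear V -> V}.

Section Endo.
Variables (K : comNzRingType) (V : lmodType K).
Implicit Types f g h : endo V.

HB.instance Definition _ := gen_eqMixin (endo V).
HB.instance Definition _ := gen_choiceMixin (endo V).

Definition endo_app f : V -> V := f.

Lemma endoP f g : endo_app f =1 endo_app g -> f = g.
Proof.
rewrite /endo_app; case: f g => [f [[fD] [fZ]]] [g [[gD] [gZ]]] /= /funext fg.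
move: fD fZ gD gZ; rewrite {}fg => fD fZ gD gZ.
by rewrite (Prop_irrelevance fD gD) (Prop_irrelevance fZ gZ).
Qed.

Definition endo_zero : endo V := \0.
Definition endo_opp f : endo V := \- f.
Definition endo_add f g : endo V := f \+ g.
Definition endo_scale c f : endo V := c \*: f.
Definition endo_one : endo V := idfun.
Definition endo_mul f g : endo V := f \o g.

Fact endo_addA : associative endo_add.
Proof. by move=> f g h; apply: endoP => x; apply: addrA. Qed.
Fact endo_addC : commutative endo_add.
Proof. by move=> f g; apply: endoP => x; apply: addrC. Qed.
Fact endo_add0 : left_id endo_zero endo_add.
Proof. by move=> f; apply: endoP => x; apply: add0r. Qed.
Fact endo_addN : left_inverse endo_zero endo_opp endo_add.
Proof. by move=> f; apply: endoP => x; apply: addNr. Qed.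
HB.instance Definition _ := GRing.isZmodule.Build (endo V)
  endo_addA endo_addC endo_add0 endo_addN.

Fact endo_scaleA a b f : endo_scale a (endo_scale b f) = endo_scale (a * b) f.
Proof. by apply: endoP => x; apply: scalerA. Qed.
Fact endo_scale1 : left_id 1 endo_scale.
Proof. by move=> f; apply: endoP => x; apply: scale1r. Qed.
Fact endo_scaleDr : right_distributive endo_scale +%R.
Proof. by move=> a f g; apply: endoP => x; apply: scalerDr. Qed.
Fact endo_scaleDl f : {morph endo_scale^~ f : a b / a + b}.
Proof. by move=> a b; apply: endoP => x; apply: scalerDl. Qed.
HB.instance Definition _ := GRing.Zmodule_isLmodule.Build K (endo V)
  endo_scaleA endo_scale1 endo_scaleDr endo_scaleDl.

Fact endo_mulA : associative endo_mul.
Proof. by move=> f g h; apply: endoP. Qed.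
Fact endo_mul1 : left_id endo_one endo_mul.
Proof. by move=> f; apply: endoP. Qed.
Fact endo_1mul : right_id endo_one endo_mul.
Proof. by move=> f; apply: endoP. Qed.
Fact endo_mulDl : left_distributive endo_mul +%R.
Proof. by move=> f g h; apply: endoP. Qed.
Fact endo_mulDr : right_distributive endo_mul +%R.
Proof. by move=> f g h; apply: endoP => x; apply: raddfD. Qed.
HB.instance Definition _ := GRing.Zmodule_isPzRing.Build (endo V)
  endo_mulA endo_mul1 endo_1mul endo_mulDl endo_mulDr.

Lemma endo_scalerAl a f g : a *: (f * g) = (a *: f) * g.
Proof. by apply: endoP. Qed.
Lemma endo_scalerAr a f g : a *: (f * g) = f * (a *: g).
Proof. by apply: endoP => x; rewrite /endo_app /= linearZ. Qed.

Lemma endo_neq0 (v : V) : v != 0 -> (1 : endo V) != 0.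
Proof. by apply: contra => /eqP/(congr1 (fun f => endo_app f v))/eqP. Qed.

End Endo.

HB.mixin Record isMulrClosed (R : nzRingType) (S : R -> bool) := {
  ideal_mulr : forall a u, u \in S -> u * a \in S
}.

#[short(type="ideal2")]
HB.structure Definition Ideal2 (R : nzRingType) :=
  {S of Idealr R S & isMulrClosed R S}.

Definition quot2 (K : comNzRingType) (A : algType K) (I : ideal2 A) :=
  Quotient.quot I.

Section Quotient2.
Variables (K : comNzRingType) (A : algType K) (I : ideal2 A).
Local Notation Q := (quot2 I).

HB.instance Definition _ := GRing.Zmodule.on Q.
HB.instance Definition _ : EqQuotient A (Quotient.equiv I) Q :=
  EqQuotient.on Q.
HB.instance Definition _ :
    ZmodQuotient A (Quotient.equiv I) 0 -%R +%R Q := ZmodQuotient.on Q.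

Lemma ideal_mull a u : u \in I -> a * u \in I.
Proof. by move=> h; apply: proper_ideal_subproof.2. Qed.

Lemma quot2_eq (x y : A) : (\pi_Q x = \pi_Q y) <-> (x - y \in I).
Proof.
by split=> [/eqP|h]; [|apply/eqP]; rewrite -Quotient.idealrBE.
Qed.

Definition quot2_one : Q := \pi_Q 1.
Definition quot2_mul (x y : Q) : Q := \pi_Q (repr x * repr y).
Definition quot2_scale (c : K) (x : Q) : Q := \pi_Q (c *: repr x).

Lemma quot2_pi0 : \pi_Q 0 = 0 :> Q.
Proof. by rewrite /GRing.zero /= /Quotient.zero -lock. Qed.

Lemma quot2_piD (x y : A) : \pi_Q (x + y) = \pi_Q x + \pi_Q y :> Q.
Proof. exact: (Quotient.pi_add I x y). Qed.

Lemma quot2_piM (x y : A) : \pi_Q (x * y) = quot2_mul (\pi_Q x) (\pi_Q y).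
Proof.
apply/quot2_eq.
have hx : x - repr (\pi_Q x) \in I by apply/quot2_eq; rewrite reprK.
have hy : y - repr (\pi_Q y) \in I by apply/quot2_eq; rewrite reprK.
set x' := repr _ in hx *; set y' := repr _ in hy *.
have -> : x * y - x' * y' = (x - x') * y + x' * (y - y').
  by rewrite mulrBl mulrBr addrA addrNK.
by apply: rpredD; [apply: ideal_mulr | apply: ideal_mull].
Qed.

Lemma quot2_piZ c (x : A) : \pi_Q (c *: x) = quot2_scale c (\pi_Q x).
Proof.
apply/quot2_eq; rewrite -scalerBr -mulr_algl; apply: ideal_mull.
by apply/quot2_eq; rewrite reprK.
Qed.

Fact quot2_mulA : associative quot2_mul.
Proof.
move=> x y z; rewrite -[x]reprK -[y]reprK -[z]reprK.
move: (repr x) (repr y) (repr z) => {}x {}y {}z.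
by rewrite -(quot2_piM y z) -(quot2_piM x y) -!quot2_piM mulrA.
Qed.
Fact quot2_mul1 : left_id quot2_one quot2_mul.
Proof. by move=> x; rewrite -[x]reprK -(quot2_piM 1 (repr x)) mul1r. Qed.
Fact quot2_1mul : right_id quot2_one quot2_mul.
Proof. by move=> x; rewrite -[x]reprK -(quot2_piM (repr x) 1) mulr1. Qed.
Fact quot2_mulDl : left_distributive quot2_mul +%R.
Proof.
move=> x y z; rewrite -[x]reprK -[y]reprK -[z]reprK.
move: (repr x) (repr y) (repr z) => {}x {}y {}z.
by rewrite -(quot2_piM x z) -(quot2_piM y z) -!quot2_piD -quot2_piM mulrDl.
Qed.
Fact quot2_mulDr : right_distributive quot2_mul +%R.
Proof.
move=> x y z; rewrite -[x]reprK -[y]reprK -[z]reprK.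
move: (repr x) (repr y) (repr z) => {}x {}y {}z.
by rewrite -(quot2_piM x y) -(quot2_piM x z) -!quot2_piD -quot2_piM mulrDr.
Qed.
Fact quot2_one_neq0 : quot2_one != 0.
Proof.
by rewrite -quot2_pi0; apply/eqP => /quot2_eq; rewrite subr0 idealr1.
Qed.
HB.instance Definition _ := GRing.Zmodule_isNzRing.Build Q
  quot2_mulA quot2_mul1 quot2_1mul quot2_mulDl quot2_mulDr quot2_one_neq0.

Fact quot2_scaleA a b x : quot2_scale a (quot2_scale b x) = quot2_scale (a * b) x.
Proof. by rewrite -[x]reprK -(quot2_piZ b) -!quot2_piZ scalerA. Qed.
Fact quot2_scale1 : left_id 1 quot2_scale.
Proof. by move=> x; rewrite -[x]reprK -(quot2_piZ 1 (repr x)) scale1r. Qed.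
Fact quot2_scaleDr : right_distributive quot2_scale +%R.
Proof.
move=> a x y; rewrite -[x]reprK -[y]reprK.
move: (repr x) (repr y) => {}x {}y.
by rewrite -(quot2_piZ a x) -(quot2_piZ a y) -!quot2_piD -quot2_piZ scalerDr.
Qed.
Fact quot2_scaleDl x : {morph quot2_scale^~ x : a b / a + b}.
Proof.
move=> a b; rewrite -[x]reprK; move: (repr x) => {}x.
by rewrite -(quot2_piZ a x) -(quot2_piZ b x) -quot2_piD -quot2_piZ scalerDl.
Qed.
HB.instance Definition _ := GRing.Zmodule_isLmodule.Build K Q
  quot2_scaleA quot2_scale1 quot2_scaleDr quot2_scaleDl.

Fact quot2_scalerAl a (x y : Q) : a *: (x * y) = (a *: x) * y.
Proof.
rewrite -[x]reprK -[y]reprK; move: (repr x) (repr y) => {}x {}y.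
by rewrite -[_ * \pi_Q y]quot2_piM -[_ *: \pi_Q x]quot2_piZ
  -[LHS]quot2_piZ -[RHS]quot2_piM scalerAl.
Qed.
Fact quot2_scalerAr a (x y : Q) : a *: (x * y) = x * (a *: y).
Proof.
rewrite -[x]reprK -[y]reprK; move: (repr x) (repr y) => {}x {}y.
by rewrite -[\pi_Q x * \pi_Q y]quot2_piM -[_ *: \pi_Q y]quot2_piZ
  -[LHS]quot2_piZ -[RHS]quot2_piM scalerAr.
Qed.
HB.instance Definition _ := GRing.Lmodule_isLalgebra.Build K Q quot2_scalerAl.
HB.instance Definition _ := GRing.Lalgebra_isAlgebra.Build K Q quot2_scalerAr.

Definition quot2_pi : A -> Q := \pi_Q.

Fact quot2_pi_linear : linear quot2_pi.
Proof.
by move=> c x y; rewrite /quot2_pi quot2_piD; congr (_ + _); apply: quot2_piZ.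
Qed.
HB.instance Definition _ := GRing.isLinear.Build K A Q *:%R quot2_pi
  quot2_pi_linear.

Fact quot2_pi_monoid_morphism : monoid_morphism quot2_pi.
Proof. by split=> // x y; apply: quot2_piM. Qed.
HB.instance Definition _ := GRing.isMonoidMorphism.Build A Q quot2_pi
  quot2_pi_monoid_morphism.

Lemma quot2_pi_eq0 (x : A) : (quot2_pi x == 0) = (x \in I).
Proof.
by rewrite -quot2_pi0 -[x in RHS]subr0; apply/eqP/idP => /quot2_eq.
Qed.

Lemma quot2_pi_surj (y : Q) : exists x, quot2_pi x = y.
Proof. by exists (repr y); apply: reprK. Qed.

End Quotient2.

Definition gen_ideal (R : nzRingType) (X : R -> Prop) (x : R) : Prop :=
  forall J : R -> Prop,
    J 0 -> (forall u v, J u -> J v -> J (u - v)) ->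
    (forall a u, J u -> J (a * u)) -> (forall a u, J u -> J (u * a)) ->
    (forall r, X r -> J r) -> J x.

Definition gen_subalg (K : comNzRingType) (A : algType K) (T : Type)
    (g : T -> A) (x : A) : Prop :=
  forall S : A -> Prop,
    S 1 -> (forall (c : K) u v, S u -> S v -> S (c *: u + v)) ->
    (forall u v, S u -> S v -> S (u * v)) -> (forall i, S (g i)) -> S x.

Section GenSubalg.
Variables (K : comNzRingType) (A : algType K) (T : Type) (g : T -> A).

Definition gen_subalg_pred : pred A := fun x => `[< gen_subalg g x >].

Fact gen_subalg_closed : subalg_closed gen_subalg_pred.
Proof.
split=> [|c u v /asboolP Su /asboolP Sv|u v /asboolP Su /asboolP Sv];
  apply/asboolP => S S1 SZ SM Sg //.
- by apply: (SZ); [apply: Su | apply: Sv].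
- by apply: (SM); [apply: Su | apply: Sv].
Qed.

HB.instance Definition _ :=
  GRing.isSubalgClosed.Build K A gen_subalg_pred
    (GRing.subalg_closed_semi gen_subalg_closed).

Definition subalg := {x : A | gen_subalg_pred x}.
HB.instance Definition _ := SubChoice.on subalg.
HB.instance Definition _ := [SubChoice_isSubAlgebra of subalg by <:].

Fact gen_subalg_gen i : gen_subalg_pred (g i).
Proof. by apply/asboolP => S _ _ _ Sg; apply: Sg. Qed.

Definition subalg_gen (i : T) : subalg := Sub (g i) (gen_subalg_gen i).

End GenSubalg.

(* [P false] and [P true] are the even and the odd part. *)
Record is_superalgebra (K : comNzRingType) (A : algType K)
    (P : bool -> A -> Prop) : Prop := IsSuperalgebra {
  super0 : forall s, P s 0;
  superZD : forall s (c : K) u v, P s u -> P s v -> P s (c *: u + v);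
  super1 : P false 1;
  superM : forall s t u v, P s u -> P t v -> P (s (+) t) (u * v);
  super_direct : forall a,
    exists! p : A * A, [/\ P false p.1, P true p.2 & a = p.1 + p.2]
}.

(* The part of parity [s] for the grading induced by generators [g i], [g i]
   being odd iff [odd_gen i]: linear combinations of words in the generators
   whose number of odd letters has parity [s]. *)
Definition generator_parity (K : comNzRingType) (A : algType K) (T : Type)
    (odd_gen : pred T) (g : T -> A) (s : bool) (a : A) : Prop :=
  exists r : seq (K * seq T),
    all (fun cw => odd (count odd_gen cw.2) == s) r /\
    a = \sum_(cw <- r) cw.1 *: \prod_(i <- cw.2) g i.

Definition superalgebra_iso (K : comNzRingType)
    (A : algType K) (PA : bool -> A -> Prop)
    (B : algType K) (PB : bool -> B -> Prop) : Prop :=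
  exists f : {lrmorphism A -> B},
    bijective f /\ forall s a, PA s a <-> PB s (f a).

(* The index set [I] is ['I_(m + n)]; [i] lies in [I_0] iff [i < m]. *)
Definition odd_index (m n : nat) : pred 'I_(m + n) := fun i => (m <= i)%N.

Definition free_alg (K : comNzRingType) (T : choiceType) :=
  {malg K[{fmonom T}]}.

Section FreeAlg.
Variables (K : comNzRingType) (T : choiceType).
HB.instance Definition _ := GRing.Lalgebra.on (free_alg K T).

Fact free_alg_scalerAr (a : K) (x y : free_alg K T) :
  a *: (x * y) = x * (a *: y).
Proof.
apply: (iffLR (malgP _ _)) => k; rewrite [LHS]mcoeffZ [in LHS]mcoeffMl.
rewrite (mcoeffMlw k (fsubset_refl (msupp x)) (msuppZ_le a y)) mulr_sumr.
apply: eq_bigr => k1 _; rewrite mulr_sumr; apply: eq_bigr => k2 _.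
by rewrite mcoeffZ mulrnAr mulrCA.
Qed.
HB.instance Definition _ :=
  GRing.Lalgebra_isAlgebra.Build K (free_alg K T) free_alg_scalerAr.

Definition free_gen (i : T) : free_alg K T := << fmu i >>.
End FreeAlg.

Section QuantumSuperspace.
Variables (K : fieldType) (q : K) (m n : nat).
Local Notation F := (free_alg K 'I_(m + n)).
Local Notation v := (@free_gen K 'I_(m + n)).

Inductive Aq_rel : F -> Prop :=
| Aq_rel_even (i j : 'I_(m + n)) of (i < m)%N & (i < j)%N :
    Aq_rel (v j * v i - q *: (v i * v j))
| Aq_rel_sqr (i : 'I_(m + n)) of (m <= i)%N :
    Aq_rel (v i ^+ 2)
| Aq_rel_odd (i j : 'I_(m + n)) of (m <= i)%N & (i < j)%N :
    Aq_rel (v j * v i + q *: (v i * v j)).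

Definition Aq_ideal : pred F := fun x => `[< gen_ideal Aq_rel x >].

Fact Aq_ideal_coeff1 (x : F) :
  gen_ideal Aq_rel x -> @mcoeff {fmonom 'I_(m + n)} K mone x = 0.
Proof.
pose c0 : {rmorphism F -> K} := @mcoeff {fmonom 'I_(m + n)} K mone.
have [c [cE cM cB cZ]] : exists c : F -> K,
    [/\ c =1 @mcoeff {fmonom 'I_(m + n)} K mone, {morph c : y z / y * z},
        {morph c : y z / y - z} & forall a y, c (a *: y) = a * c y].
  exists c0; split=> // [y z|y z|a y].
  - exact: (rmorphM c0).
  - exact: (rmorphB c0).
  - exact: mcoeffZ.
have c00 : c 0 = 0 by rewrite -(subrr 0) cB subrr.
have vv i j : c (v i * v j) = 0 by rewrite cM cE mcoeffU fm1_eq1 mul0r.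
have cBZ a y z : c y = 0 -> c z = 0 -> c (y - a *: z) = 0.
  by move=> y0 z0; rewrite cB cZ y0 z0 mulr0 subr0.
rewrite -cE => /(_ (fun y => c y = 0)).
apply=> [|x1 x2 h1 h2|a u h|a u h|r [i j _ _|i _|i j _ _]] //.
- by rewrite cB h1 h2 subr0.
- by rewrite cM h mulr0.
- by rewrite cM h mul0r.
- exact: (cBZ _ _ _ (vv j i) (vv i j)).
- exact: vv.
- by rewrite -[q]opprK scaleNr; exact: (cBZ _ _ _ (vv j i) (vv i j)).
Qed.

Fact Aq_idealr_closed : idealr_closed Aq_ideal.
Proof.
split=> [||a u w /asboolP hu /asboolP hw].
- by apply/asboolP => J.
- apply/asboolP => /Aq_ideal_coeff1/eqP.
  by rewrite mcoeff1 eqxx oner_eq0.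
apply/asboolP => J J0 JB Jl Jr JX.
have Ju : J u by apply: hu.
have Jw : J w by apply: hw.
by rewrite -[w]opprK -[- w]sub0r; apply: (JB); [apply: Jl | apply: (JB)].
Qed.
HB.instance Definition _ := isIdealr.Build F Aq_ideal Aq_idealr_closed.

Fact Aq_ideal_mulr (a u : F) : u \in Aq_ideal -> u * a \in Aq_ideal.
Proof.
move=> /asboolP hu; apply/asboolP => J J0 JB Jl Jr JX.
by apply: (Jr); apply: hu.
Qed.
HB.instance Definition _ := isMulrClosed.Build F Aq_ideal Aq_ideal_mulr.

Definition Aq : algType K := quot2 Aq_ideal.

Definition Aq_gen (i : 'I_(m + n)) : Aq := quot2_pi Aq_ideal (v i).

Definition Aq_part : bool -> Aq -> Prop :=
  generator_parity (@odd_index m n) Aq_gen.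

End QuantumSuperspace.

(* [(alpha, mu)] indexes the basis element x^(alpha) (x) x^mu. *)
Definition omega_basis (m n : nat) : Type :=
  ({ffun 'I_m -> nat} * {ffun 'I_n -> bool})%type.
HB.instance Definition _ m n := Choice.on (omega_basis m n).

Definition Omega (K : fieldType) (m n : nat) := {malg K[omega_basis m n]}.
HB.instance Definition _ K m n := GRing.Lmodule.on (Omega K m n).

Section Omega.
Variables (K : fieldType) (q : K) (m n : nat).
Local Notation basis := (omega_basis m n).
Local Notation Omega := (Omega K m n).

Definition star (a b : 'I_(m + n) -> int) : int :=
  \sum_(i < m + n) \sum_(j < m + n | (j < i)%N) a i * b j.

Definition eps (i : 'I_(m + n)) : 'I_(m + n) -> int := fun k => (k == i)%:Z.

Definition supp0 (alpha : {ffun 'I_m -> nat}) : 'I_(m + n) -> int :=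
  fun k => if split k is inl i then (alpha i)%:Z else 0.

Definition supp1 (mu : {ffun 'I_n -> bool}) : 'I_(m + n) -> int :=
  fun k => if split k is inr i then (mu i : nat)%:Z else 0.

(* Clearing denominators,
     [s; r]_v = v^(- r (s - r)) prod_(1 <= i <= r)
                  (v^(2 (s - i + 1)) - 1) / (v^(2 i) - 1)    for r <= s.
   The quotient of products is computed in Z[v], where the division is exact
   and the divisor monic, and only then evaluated, so that [q] may be a root
   of unity. *)
Definition gauss_poly (s r : nat) : {poly int} :=
  Pdiv.Ring.rdivp (\prod_(1 <= i < r.+1) ('X^(2 * (s.+1 - i)) - 1))
                  (\prod_(1 <= i < r.+1) ('X^(2 * i) - 1)).

Definition qbinom (s r : nat) : K :=
  q ^- (r * (s - r)) * (map_poly intr (gauss_poly s r)).[q].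

Definition basis_mul (a b : basis) : Omega :=
  let: (alpha, mu) := a in let: (beta, nu) := b in
  if [exists i, mu i && nu i] then 0 else
  (q ^ star (supp1 mu) (supp0 beta) *
   (q ^ star (supp0 alpha) (supp0 beta) *
      \prod_(i < m) qbinom (alpha i + beta i) (alpha i)) *
   (- q) ^ star (supp1 mu) (supp1 nu)) *:
  << ([ffun i => alpha i + beta i]%N, [ffun i => mu i || nu i]) >>.

(* The product of the quantum Grassmann superalgebra; it does not enter the
   definition of its vector space endomorphisms or of the q-derivations. *)
Definition omega_mul (x y : Omega) : Omega :=
  \sum_(a <- msupp x) \sum_(b <- msupp y) (x@_a * y@_b) *: basis_mul a b.

Definition dq_basis (i : 'I_(m + n)) (a : basis) : Omega :=
  let: (alpha, mu) := a in
  match split i with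
  | inl i0 =>
      if alpha i0 == 0%N then 0 else
      q ^ (- star (eps i) (supp0 alpha)) *:
        << ([ffun k => (alpha k - (k == i0))%N], mu) >>
  | inr i1 =>
      if mu i1 then
        (q ^ (- star (eps i) (supp0 alpha)) *
         (- q) ^ (- star (eps i) (supp1 mu))) *:
        << (alpha, [ffun k => mu k && (k != i1)]) >>
      else 0
  end.

Definition dq_fun (i : 'I_(m + n)) (x : Omega) : Omega :=
  \sum_(a <- msupp x) x@_a *: dq_basis i a.

Fact dq_funE i (x : Omega) (d : {fset basis}) : (msupp x `<=` d)%fset ->
  dq_fun i x = \sum_(a <- d) x@_a *: dq_basis i a.
Proof.
move=> le; rewrite [LHS](big_fset_incl _ le) => //= a _ /mcoeff_outdom ->.
by rewrite scale0r.
Qed.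

Fact dq_fun_is_linear i : linear (dq_fun i).
Proof.
move=> c x y.
have hxy : (msupp (c *: x + y) `<=` msupp x `|` msupp y)%fset.
  by apply: fsubset_trans (msuppD_le _ _) (fsetUSS (msuppZ_le _ _) (fsubset_refl _)).
rewrite (dq_funE _ hxy) (dq_funE _ (fsubsetUl _ (msupp y))).
rewrite (dq_funE _ (fsubsetUr (msupp x) _)) scaler_sumr -big_split /=.
by apply: eq_bigr => a _; rewrite mcoeffD mcoeffZ scalerDl scalerA.
Qed.
HB.instance Definition _ i :=
  GRing.isLinear.Build K Omega Omega *:%R (dq_fun i) (dq_fun_is_linear i).

Definition End_Omega := endo Omega.
HB.instance Definition _ := GRing.PzRing.on End_Omega.
HB.instance Definition _ := GRing.Lmodule.on End_Omega.

Fact End_Omega_neq0 : (1 : End_Omega) != 0.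
Proof.
apply: (@endo_neq0 K Omega << ([ffun=> 0%N], [ffun=> false]) >>).
by rewrite monalgU_eq0 oner_eq0.
Qed.
HB.instance Definition _ :=
  GRing.PzSemiRing_isNonZero.Build End_Omega End_Omega_neq0.
HB.instance Definition _ := GRing.Lmodule_isLalgebra.Build K End_Omega
  (@endo_scalerAl K Omega).
HB.instance Definition _ := GRing.Lalgebra_isAlgebra.Build K End_Omega
  (@endo_scalerAr K Omega).

Definition dq (i : 'I_(m + n)) : End_Omega := dq_fun i : {linear Omega -> Omega}.

Definition Dq : algType K := subalg dq.

Definition Dq_gen (i : 'I_(m + n)) : Dq := subalg_gen dq i.

Definition Dq_part : bool -> Dq -> Prop :=
  generator_parity (@odd_index m n) Dq_gen.

End Omega.

(* Main.v *)
From HB Require Import structures.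
Require Import Defs.
From mathcomp Require Import all_boot all_algebra.
From mathcomp Require Import boolp finmap.
From mathcomp.multinomials Require Import monalg.

(** Write deg x^b for the exponent vector of a basis element x^b of Omega, the
    even and the odd exponents being read off together as a function on
    'I_(m + n), and put t_k = q for k even, t_k = - q for k odd. The two cases
    in the definition of the q-derivations become the single formula
      d_i x^b = (prod_(k < i) t_k^(- deg x^b k)) x^(b - e_i),
    with d_i x^b = 0 if deg x^b i = 0 ([dq_basisE]). Lowering the exponent i
    before applying d_j, i < j, changes the coefficient of d_j by t_i, whence
    d_j d_i = t_i d_i d_j ([dq_comm]); and d_i^2 = 0 for odd i, an odd exponent
    being at most 1 ([dq_sqr]). These are the relations of A_q, so v_i |-> d_i
    defines a morphism from A_q onto D_q.

    It is injective because A_q is no larger than the relations suggest: they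
    let one reorder the letters of a word up to a scalar, so that A_q is spanned
    by the sorted words without repeated odd letter ([Aq_normal_form]). On the
    other side, for a word w the constant coefficient of d_w x^b is nonzero
    exactly when deg x^b counts the letters of w ([dq_word_pairing]). Hence each
    coefficient of a combination of normal words can be read off from the
    operator it defines, by applying the latter to the x^b with the same letters
    ([Dq_eval_normal_inj]).

    In both algebras the even and the odd part span, a combination of words
    being the sum of its even and its odd words. They meet in 0 because the
    operator S multiplying x^b by -1 to the number of its odd letters
    satisfies S d_i = (-1)^|i| d_i S: it commutes with the even part and
    anticommutes with the odd one, and 2 is invertible
    ([generator_parity_superalgebra]). *)

Set Implicit Arguments.
Unset Strict Implicit.
Unset Printing Implicit Defensive.

Import GRing.Theory.
Local Open Scope ring_scope.

(** * Linear extension from a basis *)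

Section LinearExtension.
Variables (K : comNzRingType) (B : choiceType) (V : lmodType K) (h : B -> V).

Definition linext (x : {malg K[B]}) : V := \sum_(b <- msupp x) x@_b *: h b.

Lemma linextEw (x : {malg K[B]}) (d : {fset B}) : (msupp x `<=` d)%fset ->
  linext x = \sum_(b <- d) x@_b *: h b.
Proof.
move=> le; rewrite [LHS](big_fset_incl _ le) => //= b _ /mcoeff_outdom ->.
by rewrite scale0r.
Qed.

Fact linext_is_linear : linear linext.
Proof.
move=> c x y.
have hxy : (msupp (c *: x + y) `<=` msupp x `|` msupp y)%fset.
  apply: fsubset_trans (msuppD_le _ _) (fsetUSS (msuppZ_le _ _) _).
  exact: fsubset_refl.
rewrite (linextEw hxy) (linextEw (fsubsetUl _ (msupp y))).
rewrite (linextEw (fsubsetUr (msupp x) _)) scaler_sumr -big_split /=.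
by apply: eq_bigr => b _; rewrite mcoeffD mcoeffZ scalerDl scalerA.
Qed.
HB.instance Definition _ := GRing.isLinear.Build K {malg K[B]} V *:%R linext
  linext_is_linear.

Lemma linextU c b : linext << c *g b >> = c *: h b.
Proof. by rewrite (linextEw msuppU_le) big_seq_fset1 mcoeffUU. Qed.

End LinearExtension.

Lemma malg_expand (K : comNzRingType) (B : choiceType) (x : {malg K[B]}) :
  x = \sum_(b <- msupp x) x@_b *: << b >>.
Proof.
rewrite {1}[x]monalgE; apply: eq_bigr => b _; apply: (iffLR (malgP _ _)) => k.
by rewrite mcoeffZ !mcoeffU mulrnAr mulr1.
Qed.

Lemma malg_linear_ext (K : comNzRingType) (B : choiceType) (V : lmodType K)
    (f g : {linear {malg K[B]} -> V}) :
  (forall b, f << b >> = g << b >>) -> f =1 g.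
Proof.
move=> fg x; rewrite [x]malg_expand !linear_sum.
by apply: eq_bigr => b _; rewrite !linearZ /= fg.
Qed.

(** * Evaluation of the free algebra *)

Section FreeEval.
Variables (K : comNzRingType) (T : choiceType) (A : algType K) (g : T -> A).
Local Notation F := (free_alg K T).

Definition free_eval (x : F) : A :=
  linext (fun k : {fmonom T} => \prod_(i <- k) g i) x.

Lemma free_evalE x :
  free_eval x = \sum_(k <- msupp x) x@_k *: \prod_(i <- k) g i.
Proof. by []. Qed.

Fact free_eval_linear : linear free_eval.
Proof. exact: linext_is_linear. Qed.
HB.instance Definition _ := GRing.isLinear.Build K F A *:%R free_eval
  free_eval_linear.

Lemma free_evalU c k : free_eval << c *g k >> = c *: \prod_(i <- k) g i.
Proof. exact: linextU. Qed.

Fact free_eval_monoid_morphism : monoid_morphism free_eval.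
Proof.
split=> [|x y].
  have -> : (1 : F) = << 1 *g mone >> by [].
  by rewrite free_evalU scale1r fm1 big_nil.
have -> : x * y = \sum_(k <- msupp x) \sum_(l <- msupp y)
    << x@_k * y@_l *g (mmul k l) >> by apply: malgME.
rewrite linear_sum !free_evalE mulr_suml.
apply: eq_bigr => k _; rewrite linear_sum mulr_sumr; apply: eq_bigr => l _.
by rewrite [LHS]free_evalU fmM big_cat -scalerAl -scalerAr scalerA.
Qed.
HB.instance Definition _ := GRing.isMonoidMorphism.Build F A free_eval
  free_eval_monoid_morphism.

Lemma free_eval_gen i : free_eval (free_gen K i) = g i.
Proof. by rewrite free_evalU scale1r fmU big_seq1. Qed.

End FreeEval.

(** The basis of the free algebra consists of the products of generators, so an
    algebra morphism out of it is determined by the images of the generators. *)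
Lemma free_wordE (K : comNzRingType) (T : choiceType) (k : {fmonom T}) :
  (<< k >> : free_alg K T) = \prod_(i <- k) free_gen K i.
Proof.
case: k => s; elim: s => [|i s IHs].
  rewrite big_nil; have -> : FMonom [::] = mone :> {fmonom T}; last by [].
  by apply/val_inj; rewrite /= fm1.
rewrite big_cons -IHs; have -> : FMonom (i :: s) = mmul (fmu i) (FMonom s).
  by apply/val_inj; rewrite /= fmM fmU.
have := fgmulUU (1 : K) 1 (fmu i) (FMonom s).
by rewrite mulr1 => <-.
Qed.

Lemma free_eval_unique (K : comNzRingType) (T : choiceType) (A : algType K)
    (f : {lrmorphism free_alg K T -> A}) :
  free_eval (fun i => f (free_gen K i)) =1 f.
Proof.
apply: malg_linear_ext => k.
by rewrite [LHS]free_evalU scale1r free_wordE rmorph_prod.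
Qed.

Lemma free_eval_comp (K : comNzRingType) (T : choiceType) (A B : algType K)
    (f : {lrmorphism A -> B}) (g : T -> A) x :
  f (free_eval g x) = free_eval (f \o g) x.
Proof.
rewrite !free_evalE linear_sum; apply: eq_bigr => k _.
by rewrite linearZ /= rmorph_prod.
Qed.

(** * Superalgebras generated by homogeneous elements *)

Section GeneratorParity.
Variables (K : fieldType) (T : choiceType) (odd_gen : pred T).

Section Closure.
Variables (A : algType K) (g : T -> A).
Local Notation P := (generator_parity odd_gen g).

Lemma generator_parity0 s : P s 0.
Proof. by exists [::]; rewrite big_nil. Qed.

Lemma generator_parity_word w : P (odd (count odd_gen w)) (\prod_(i <- w) g i).
Proof. by exists [:: (1, w)]; rewrite /= eqxx big_seq1 scale1r. Qed.

Lemma generator_parityZD s (c : K) u v : P s u -> P s v -> P s (c *: u + v).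
Proof.
case=> ru [ru_s ->] [rv [rv_s ->]].
exists ([seq (c * cw.1, cw.2) | cw <- ru] ++ rv); split.
  by rewrite all_cat rv_s all_map andbT.
rewrite big_cat big_map scaler_sumr; congr (_ + _).
by apply: eq_bigr => cw _; rewrite scalerA.
Qed.

Lemma generator_parityM s t u v : P s u -> P t v -> P (s (+) t) (u * v).
Proof.
case=> ru [/allP ru_s ->] [rv [/allP rv_t ->]].
exists [seq (x.1 * y.1, x.2 ++ y.2) | x <- ru, y <- rv]; split.
  apply/allP => _ /allpairsP[[x y] /= [xu yv ->]] /=.
  by rewrite count_cat oddD (eqP (ru_s _ xu)) (eqP (rv_t _ yv)).
rewrite big_allpairs_dep big_distrl; apply: eq_bigr => x _.
rewrite big_distrr; apply: eq_bigr => y _.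
by rewrite big_cat /= -scalerAl -scalerAr scalerA.
Qed.

Lemma generator_parity_sum s (J : eqType) (r : seq J) (c : J -> K)
    (f : J -> A) :
  (forall j, j \in r -> P s (f j)) -> P s (\sum_(j <- r) c j *: f j).
Proof.
elim: r => [|j r IHr] fr; first by rewrite big_nil; apply: generator_parity0.
rewrite big_cons; apply: generator_parityZD.
  by apply: fr; rewrite mem_head.
by apply: IHr => k kr; apply: fr; rewrite in_cons kr orbT.
Qed.

(** The words of an expression of an element may be sorted by parity whatever
    the relations among the generators; only the uniqueness of the two parts
    depends on them. *)
Lemma generator_parity_split (x : free_alg K T) :
  exists p : A * A, [/\ P false p.1, P true p.2 & free_eval g x = p.1 + p.2].
Proof.
pose part b := \sum_(k <- msupp x | odd (count odd_gen k) == b)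
   x@_k *: \prod_(i <- k) g i.
have partP b : P b (part b).
  rewrite /part -big_filter; apply: generator_parity_sum => k.
  by rewrite mem_filter => /andP[/eqP <- _]; apply: generator_parity_word.
exists (part false, part true); split=> //.
rewrite free_evalE.
rewrite (bigID (fun k : {fmonom T} => odd (count odd_gen k) == false)).
by congr (_ + _); apply: eq_bigl => k; case: odd.
Qed.

End Closure.

Lemma generator_parity_morph (A B : algType K) (f : {lrmorphism A -> B})
    (g : T -> A) (h : T -> B) s a : (forall i, f (g i) = h i) ->
  generator_parity odd_gen g s a -> generator_parity odd_gen h s (f a).
Proof.
move=> fg [r [r_s ->]]; exists r; split=> //; rewrite linear_sum.
apply: eq_bigr => cw _; rewrite linearZ /= rmorph_prod.
by congr (_ *: _); apply: eq_bigr => i _; apply: fg.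
Qed.

(** The sum of the two parts is direct as soon as some [S], in an algebra [B]
    containing [A], tells even generators from odd ones by conjugation. [S] is
    sought outside [A] because the parity operator is in general not a
    combination of products of q-derivations. *)
Variables (A B : algType K) (g : T -> A) (iota : {lrmorphism A -> B}) (S : B).
Hypothesis two_neq0 : 2%:R != 0 :> K.
Hypothesis iota_inj : injective iota.
Hypothesis S_invol : S * S = 1.
Hypothesis S_gen : forall i,
  S * iota (g i) = (-1) ^+ odd_gen i *: (iota (g i) * S).

Lemma sign_generator_parity s a : generator_parity odd_gen g s a ->
  S * iota a = (-1) ^+ s *: (iota a * S).
Proof.
case=> r [/allP r_s ->]; rewrite linear_sum mulr_sumr mulr_suml scaler_sumr.
apply: eq_big_seq => cw /r_s/eqP <-; rewrite signr_odd.
rewrite linearZ -scalerAl -scalerAr scalerA mulrC -scalerA; congr (_ *: _).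
rewrite /= rmorph_prod; elim: cw.2 => [|i w IHw].
  by rewrite big_nil /= mulr1 mul1r scale1r.
rewrite big_cons mulrA S_gen -scalerAl -mulrA IHw /= exprD -scalerAr scalerA.
by rewrite mulrA.
Qed.

Lemma generator_parity_disjoint a :
  generator_parity odd_gen g false a -> generator_parity odd_gen g true a ->
  a = 0.
Proof.
move=> /sign_generator_parity a0 /sign_generator_parity.
rewrite a0 scale1r scaleN1r => /eqP; rewrite -addr_eq0 -mulr2n -scaler_nat.
rewrite scaler_eq0 (negPf two_neq0) /= => /eqP aS0.
apply: iota_inj; rewrite linear0.
by rewrite -[iota a]mulr1 -S_invol mulrA aS0 mul0r.
Qed.

Lemma generator_parity_superalgebra :
  (forall a, exists x, free_eval g x = a) ->
  is_superalgebra (generator_parity odd_gen g).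
Proof.
move=> g_gen; split.
- exact: generator_parity0.
- by move=> *; apply: generator_parityZD.
- by have := generator_parity_word g [::]; rewrite big_nil.
- by move=> *; apply: generator_parityM.
move=> a; have [x <-] := g_gen a.
have [p [p0 p1 ->]] := generator_parity_split g x; exists p; split=> // p'.
case=> p'0 p'1 e.
have d : p.1 - p'.1 = p'.2 - p.2.
  by apply/eqP; rewrite subr_eq addrAC eq_sym subr_eq [p'.2 + _]addrC e.
have d0 : p.1 - p'.1 = 0.
  apply: generator_parity_disjoint.
    by rewrite addrC -scaleN1r; apply: generator_parityZD.
  by rewrite d addrC -scaleN1r; apply: generator_parityZD.
move: d; rewrite d0; move/eqP: d0; rewrite subr_eq0 => /eqP d0.
move/eqP; rewrite eq_sym subr_eq0 => /eqP d1.
by rewrite [p]surjective_pairing [p']surjective_pairing d0 d1.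
Qed.

End GeneratorParity.

(** * The q-derivations on the basis *)

HB.instance Definition _ (K : comNzRingType) (V : lmodType K) (f : endo V) :=
  GRing.Linear.copy (endo_app f) f.

Section QDerivations.
Variables (K : fieldType) (q : K) (q_neq0 : q != 0) (m n : nat).
Local Notation basis := (omega_basis m n).
Local Notation I := 'I_(m + n).

(** The type [Omega], rather than that of [<< b >>], makes the inferred module
    structure the one on which the q-derivations are linear. *)
Definition omega_elt (b : basis) : Omega K m n := << b >>.

Definition deg (b : basis) (k : I) : nat :=
  match split k with inl i => b.1 i | inr i => b.2 i end.

(** On odd exponents, [&&] is the truncated subtraction of [deg_lower]. *)
Definition lower (i : I) (b : basis) : basis :=
  ([ffun k => b.1 k - (lshift n k == i)]%N,
   [ffun k => b.2 k && (rshift m k != i)]).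

Definition twist (k : I) : K := if (k < m)%N then q else - q.

(** Since star (eps i) b is the sum of the b_k, k < i, the powers of q and - q
    in the definition of the q-derivations are gathered here in one product,
    for even and odd [i] alike. *)
Definition dq_coef (i : I) (b : basis) : K :=
  \prod_(k < m + n | (k < i)%N) twist k ^- deg b k.

Lemma deg_inj b c : deg b =1 deg c -> b = c.
Proof.
case: b c => [a u] [a' u'] e; congr (_, _); apply/ffunP => i.
- by have:= e (lshift n i); rewrite /deg (unsplitK (inl i)).
- have:= e (rshift m i); rewrite /deg (unsplitK (inr i)) /=.
  by case: (u i) (u' i) => [] [].
Qed.

Lemma deg_le1 b k : odd_index k -> (deg b k <= 1)%N.
Proof.
rewrite /odd_index /deg; case: splitP => [i ->|i _ _]; last by case: (b.2 i).
by rewrite leqNgt ltn_ord.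
Qed.

Lemma deg_lower i b k : deg (lower i b) k = (deg b k - (k == i))%N.
Proof.
rewrite /deg /lower -[in k == i](splitK k).
case: (split k) => j /=; rewrite ffunE //.
by case: (b.2 j) => //=; case: eqP.
Qed.

Lemma twist_neq0 k : twist k != 0.
Proof. by rewrite /twist; case: ifP; rewrite ?oppr_eq0. Qed.

Lemma dq_coef_neq0 i b : dq_coef i b != 0.
Proof.
by apply/prodf_neq0 => k _; rewrite invr_neq0 // expf_neq0 // twist_neq0.
Qed.

Lemma star_eps (i : I) (a : I -> int) :
  star (eps i) a = \sum_(k < m + n | (k < i)%N) a k.
Proof.
rewrite /star (bigD1 i) //= [X in _ + X]big1 ?addr0 => [|j ji].
  by apply: eq_bigr => k _; rewrite /eps eqxx mul1r.
by rewrite big1 // => k _; rewrite /eps (negPf ji) mul0r.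
Qed.

Lemma exprz_opp_sum (c : K) (P : pred I) (a : I -> nat) : c != 0 ->
  c ^ (- \sum_(k | P k) (a k)%:Z) = \prod_(k | P k) c ^- a k.
Proof.
move=> c0; rewrite -sumrN.
rewrite (big_morph (fun z => c ^ z) (fun x y => expfzDr x y c0) (expr0z c)).
by apply: eq_bigr => k _; rewrite exprnN.
Qed.

Lemma dq_coefE i b : dq_coef i b =
  q ^ (- star (eps i) (supp0 b.1)) * (- q) ^ (- star (eps i) (supp1 b.2)).
Proof.
have E0 : supp0 b.1 =1 fun k => (if (k < m)%N then deg b k else 0)%N%:Z.
  by move=> k; rewrite /supp0 /deg; case: splitP.
have E1 : supp1 b.2 =1 fun k => (if (k < m)%N then 0 else deg b k)%N%:Z.
  by move=> k; rewrite /supp1 /deg; case: splitP.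
rewrite !star_eps !(eq_bigr _ (fun k _ => E0 k)) !(eq_bigr _ (fun k _ => E1 k)).
rewrite !exprz_opp_sum ?oppr_eq0 // -big_split; apply: eq_bigr => k _ /=.
by rewrite /twist; case: ifP; rewrite expr0 invr1 ?mulr1 ?mul1r.
Qed.

(** Below an even index all indices are even, so the power of - q is trivial. *)
Lemma dq_coef_even (i : I) b : (i < m)%N ->
  dq_coef i b = q ^ (- star (eps i) (supp0 b.1)).
Proof.
move=> im; rewrite dq_coefE [star _ (supp1 _)]star_eps big1 ?mulr1 // => k ki.
rewrite /supp1; case: splitP => // j kj.
by have:= ltn_trans ki im; rewrite kj ltnNge leq_addr.
Qed.

Lemma dq_basisE i b : dq_basis q i b =
  if deg b i == 0%N then 0 else dq_coef i b *: omega_elt (lower i b).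
Proof.
case: b => al mu; rewrite /dq_basis /deg /lower /=.
case: splitP => i0 ei.
  have im : (i < m)%N by rewrite ei.
  rewrite (dq_coef_even _ im) /=.
  have <- : [ffun k => al k - (k == i0)]%N =
            [ffun k => al k - (lshift n k == i)]%N.
    by apply/ffunP => k; rewrite !ffunE -!val_eqE /= ei.
  have -> : [ffun k => mu k && (rshift m k != i)] = mu.
    apply/ffunP => k; rewrite !ffunE -val_eqE /= ei.
    by rewrite gtn_eqF ?andbT // (leq_trans (ltn_ord i0)) ?leq_addr.
  by [].
rewrite dq_coefE /=.
have <- : [ffun k => mu k && (k != i0)] = [ffun k => mu k && (rshift m k != i)].
  by apply/ffunP => k; rewrite !ffunE -!val_eqE /= ei eqn_add2l.
have -> : [ffun k => al k - (lshift n k == i)]%N = al.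
  apply/ffunP => k; rewrite !ffunE -val_eqE /= ei.
  by rewrite ltn_eqF ?subn0 // (leq_trans (ltn_ord k)) ?leq_addr.
by case: (mu i0).
Qed.

Lemma dqU i b : dq_fun q i (omega_elt b) =
  if deg b i == 0%N then 0 else dq_coef i b *: omega_elt (lower i b).
Proof. by rewrite -dq_basisE -[RHS]scale1r; apply: linextU. Qed.

Lemma lowerC i j b : lower i (lower j b) = lower j (lower i b).
Proof. by apply: deg_inj => k; rewrite !deg_lower subnAC. Qed.

(** This is the only source of noncommutativity: the coefficient of the j-th
    q-derivation sees the exponents below [j] and hence the lowering at [i],
    while that of the i-th one does not see the lowering at [j]. *)
Lemma dq_coef_lower_lt (i j : I) b : (i < j)%N -> deg b i != 0%N ->
  dq_coef j (lower i b) = twist i * dq_coef j b.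
Proof.
move=> ij bi; rewrite /dq_coef (bigD1 i) //= [in RHS](bigD1 i) //= mulrA.
congr (_ * _); last first.
  by apply: eq_bigr => k /andP[_ ki]; rewrite deg_lower (negPf ki) subn0.
rewrite deg_lower eqxx; case: (deg b i) bi => // d _.
by rewrite subn1 /= exprS invfM mulrA mulfV ?mul1r ?twist_neq0.
Qed.

Lemma dq_coef_lower_ge (i j : I) b : (i <= j)%N ->
  dq_coef i (lower j b) = dq_coef i b.
Proof.
move=> ij; apply: eq_bigr => k ki; rewrite deg_lower.
by rewrite -val_eqE ltn_eqF ?subn0 // (leq_trans ki).
Qed.

Lemma endo_ext (f g : endo (Omega K m n)) :
  (forall b, endo_app f (omega_elt b) = endo_app g (omega_elt b)) -> f = g.
Proof. by move=> fg; apply: endoP; apply: malg_linear_ext. Qed.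

Lemma dq_mulE i j b :
  endo_app (dq q i * dq q j) (omega_elt b) =
  dq_fun q i (dq_fun q j (omega_elt b)).
Proof. by []. Qed.

Lemma dq_dqU i j b : dq_fun q i (dq_fun q j (omega_elt b)) =
  if (deg b j == 0%N) || (deg b i == (i == j))%N then 0 else
  (dq_coef j b * dq_coef i (lower j b)) *: omega_elt (lower i (lower j b)).
Proof.
rewrite dqU; case: (deg b j =P 0%N) => [_|/eqP bj]; first exact: linear0.
rewrite linearZ /= dqU deg_lower; case: (altP (i =P j)) => [->|_].
  rewrite subn1; case: (deg b j) bj => [|[|d]] bj; first by case/eqP: bj.
    exact: scaler0.
  exact: scalerA.
by rewrite subn0; case: (deg b i == 0%N); rewrite ?scaler0 ?scalerA.
Qed.

Lemma dq_comm (i j : I) : (i < j)%N ->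
  dq q j * dq q i = twist i *: (dq q i * dq q j).
Proof.
move=> ij; apply: endo_ext => b.
transitivity (twist i *: dq_fun q i (dq_fun q j (omega_elt b))); last by [].
have nij : (i == j) = false by rewrite -val_eqE ltn_eqF.
rewrite dq_mulE !dq_dqU [j == i]eq_sym nij orbC.
case: (boolP (_ || _)) => [_|/norP[bj bi]]; first by rewrite scaler0.
rewrite scalerA lowerC (dq_coef_lower_lt ij bi) (dq_coef_lower_ge _ (ltnW ij)).
by rewrite mulrCA [dq_coef i b * _]mulrC.
Qed.

Lemma dq_sqr (i : I) : odd_index i -> dq q i ^+ 2 = 0.
Proof.
move=> oi; apply: endo_ext => b; rewrite expr2 dq_mulE dq_dqU eqxx.
by have:= deg_le1 b oi; case: (deg b i) => [|[|?]].
Qed.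

Definition vacuum : basis := ([ffun=> 0%N], [ffun=> false]).

Lemma deg_vacuum k : deg vacuum k = 0%N.
Proof. by rewrite /deg; case: (split k) => j; rewrite ffunE. Qed.

(** Each letter of [w] lowers one exponent and contributes a nonzero scalar, so
    the constant term survives exactly when the letters of [w] use up all the
    exponents of [b]. This makes the words, taken up to reordering and without
    repeated odd letter, dual to the basis of Omega. *)
Lemma dq_word_pairing (w : seq I) b :
  mcoeff vacuum (endo_app (\prod_(i <- w) dq q i) (omega_elt b)) != 0 <->
  forall i, deg b i = count_mem i w.
Proof.
(* The last letter of the word acts first. *)
elim/last_ind: w b => [|w i IHw] b.
  have -> : endo_app (\prod_(i <- [::]) dq q i) (omega_elt b) = << b >>.
    by rewrite big_nil.
  rewrite mcoeffU; case: (b =P vacuum) => [->|nb] /=; rewrite ?oner_eq0 ?eqxx.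
    by split=> // _ k; rewrite deg_vacuum.
  by split=> // e; case: nb; apply: deg_inj => k; rewrite deg_vacuum e.
have -> : endo_app (\prod_(j <- rcons w i) dq q j) (omega_elt b) =
    endo_app (\prod_(j <- w) dq q j) (dq_fun q i (omega_elt b)).
  by rewrite -cats1 big_cat big_seq1.
have cnt k : count_mem k (rcons w i) = (count_mem k w + (k == i))%N.
  by rewrite -cats1 count_cat /= addn0 eq_sym.
rewrite dqU; case: ifP => [/eqP bi|bi].
  rewrite linear0 mcoeff0 eqxx; split=> // /(_ i).
  by rewrite bi cnt eqxx addn1.
rewrite linearZ mcoeffZ mulf_eq0 (negPf (dq_coef_neq0 i b)) /=.
rewrite IHw; split=> e k; have:= e k; rewrite deg_lower cnt.
  case: eqP => [->|_]; last by rewrite subn0 addn0.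
  by move=> <-; rewrite subnK // lt0n bi.
by case: eqP => [->|_] ->; rewrite ?addnK ?subn0 ?addn0.
Qed.

End QDerivations.

(** * The parity operator *)

Section ParityOperator.
Variables (K : fieldType) (q : K) (q_neq0 : q != 0) (m n : nat).

Definition odd_deg (b : omega_basis m n) : nat :=
  \sum_(k | @odd_index m n k) deg b k.

Lemma odd_deg_lower i b : deg b i != 0%N ->
  odd_deg b = (odd_index i + odd_deg (lower i b))%N.
Proof.
move=> bi; rewrite /odd_deg (eq_bigr (fun k => deg (lower i b) k + (k == i))%N).
  rewrite big_split /= [RHS]addnC; congr (_ + _)%N.
  rewrite big_mkcond (bigD1 i) //= eqxx big1 ?addn0 => [|k /negPf ->].
    by case: odd_index.
  by case: ifP.
move=> k _; rewrite deg_lower.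
case: (k =P i) => [->|_]; last by rewrite subn0 addn0.
by rewrite subnK // lt0n.
Qed.

Definition parity_fun : Omega K m n -> Omega K m n :=
  linext (fun b => (-1) ^+ odd_deg b *: omega_elt K b).

Fact parity_fun_linear : linear parity_fun.
Proof. exact: linext_is_linear. Qed.
HB.instance Definition _ := GRing.isLinear.Build K (Omega K m n) (Omega K m n)
  *:%R parity_fun parity_fun_linear.

Definition parity_op : End_Omega K m n :=
  parity_fun : {linear Omega K m n -> Omega K m n}.

Lemma parity_funU b :
  parity_fun (omega_elt K b) = (-1) ^+ odd_deg b *: omega_elt K b.
Proof. by rewrite -[RHS]scale1r; apply: linextU. Qed.

Lemma parity_op_invol : parity_op * parity_op = 1.
Proof.
apply: endo_ext => b.
transitivity (parity_fun (parity_fun (omega_elt K b))); first by [].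
rewrite parity_funU linearZ /= parity_funU scalerA -expr2 sqrr_sign.
exact: scale1r.
Qed.

(** The exponents i with odd [i] are exactly the ones that [odd_deg] counts, so
    lowering at [i] flips the sign precisely when [i] is odd. *)
Lemma parity_op_dq i :
  parity_op * dq q i = (-1) ^+ odd_index i *: (dq q i * parity_op).
Proof.
apply: endo_ext => b.
transitivity (parity_fun (dq_fun q i (omega_elt K b))); first by [].
transitivity ((-1) ^+ odd_index i *: dq_fun q i (parity_fun (omega_elt K b)));
  last by [].
rewrite parity_funU [in RHS]linearZ /= (dqU q_neq0).
case: (boolP (deg b i == 0%N)) => bi; first by rewrite linear0 !scaler0.
rewrite linearZ /= parity_funU !scalerA (odd_deg_lower bi) exprD mulrA.
by rewrite -expr2 sqrr_sign mul1r mulrC.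
Qed.

End ParityOperator.

(** * Normal words in the quantum superspace *)

Section QuasiCommutation.
Variables (K : comNzRingType) (A : algType K) (T : eqType) (g : T -> A).
Hypothesis g_comm : forall i j, exists c : K, g i * g j = c *: (g j * g i).

(** Moving one word past another multiplies the scalars of all the pairs of
    letters that are exchanged; their value does not matter, only that they
    exist. *)
Lemma word_commute u w : exists c : K,
  (\prod_(i <- u) g i) * (\prod_(i <- w) g i) =
  c *: ((\prod_(i <- w) g i) * (\prod_(i <- u) g i)).
Proof.
elim: u => [|i u [c ucw]].
  by exists 1; rewrite big_nil mul1r mulr1 scale1r.
suff [d iw] : exists d : K,
    g i * (\prod_(j <- w) g j) = d *: ((\prod_(j <- w) g j) * g i).
  exists (c * d); rewrite big_cons -mulrA ucw -scalerAr [g i * (_ * _)]mulrA iw.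
  by rewrite -scalerAl scalerA -[in LHS]mulrA.
elim: w {ucw} => [|j w [d iw]].
  by exists 1; rewrite big_nil mul1r mulr1 scale1r.
have [e ij] := g_comm i j; exists (e * d).
by rewrite big_cons mulrA ij -scalerAl -!mulrA iw -scalerAr scalerA.
Qed.

Lemma word_perm u w : perm_eq u w ->
  exists c : K, \prod_(i <- u) g i = c *: \prod_(i <- w) g i.
Proof.
move=> uw.
pose P w := exists c : K, \prod_(i <- u) g i = c *: \prod_(i <- w) g i.
apply: (@catCA_perm_ind _ P _ u w uw); last by exists 1; rewrite scale1r.
move=> s1 s2 s3 [c e].
have [d s12] := word_commute s1 s2; exists (c * d).
by rewrite e !big_cat /= !mulrA s12 -scalerAl scalerA.
Qed.

End QuasiCommutation.

Section Superspace.
Variables (K : fieldType) (q : K) (q_neq0 : q != 0) (m n : nat).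
Local Notation I := 'I_(m + n).
Local Notation F := (free_alg K I).
Local Notation pi := (quot2_pi (@Aq_ideal K q m n)).
Local Notation a_ := (@Aq_gen K q m n).

Lemma Aq_rel_mem x : Aq_rel q x -> x \in @Aq_ideal K q m n.
Proof. by move=> h; apply/asboolP => J _ _ _ _; apply. Qed.

(** The mixed and even relations, with scalar q, and the odd ones, with scalar
    - q, differ only in the parity of the smaller index. *)
Lemma Aq_gen_comm (i j : I) : (i < j)%N ->
  a_ j * a_ i = twist q i *: (a_ i * a_ j).
Proof.
move=> ij; rewrite /Aq_gen -!rmorphM -linearZ.
apply/eqP; rewrite -subr_eq0 -rmorphB quot2_pi_eq0; apply: Aq_rel_mem.
rewrite /twist; case: ltnP => im; first exact: Aq_rel_even.
rewrite (scaleNr q (free_gen K i * free_gen K j)).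
rewrite (opprK (q *: (free_gen K i * free_gen K j))).
exact: Aq_rel_odd.
Qed.

Lemma Aq_gen_sqr (i : I) : odd_index i -> a_ i ^+ 2 = 0.
Proof.
move=> oi; rewrite /Aq_gen -rmorphXn.
by apply/eqP; rewrite quot2_pi_eq0; apply: Aq_rel_mem; constructor.
Qed.

Lemma Aq_gen_qcomm (i j : I) : exists c : K, a_ i * a_ j = c *: (a_ j * a_ i).
Proof.
case: (ltngtP i j) => [ij|ji|/val_inj ->]; last by exists 1; rewrite scale1r.
  exists (twist q i)^-1; rewrite (Aq_gen_comm ij) scalerA.
  by rewrite (mulVf (twist_neq0 q_neq0 i)) scale1r.
by exists (twist q j); exact: Aq_gen_comm.
Qed.

Definition normal_word (w : seq I) : bool :=
  sorted (fun i j : I => i <= j)%N w &&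
  [forall i, odd_index i ==> (count_mem i w <= 1)%N].

Lemma normal_word_inj u w : normal_word u -> normal_word w ->
  (forall i, count_mem i u = count_mem i w) -> u = w.
Proof.
move=> /andP[su _] /andP[sw _] uw; apply: (sorted_eq _ _ su sw).
- by move=> j i k; apply: leq_trans.
- by move=> i j ij; apply/val_inj/anti_leq.
- by apply/allP => i _ /=; rewrite uw.
Qed.

(** Sorting costs a scalar. If an odd letter is repeated, its two copies may be
    moved side by side, where their product vanishes. *)
Lemma Aq_word_normal (w : seq I) :
  \prod_(i <- w) a_ i = 0 \/
  exists c : K, exists2 u, normal_word u &
    \prod_(i <- w) a_ i = c *: \prod_(i <- u) a_ i.
Proof.
case: (boolP [forall i, odd_index i ==> (count_mem i w <= 1)%N]) => w1.
  right; set u := sort (fun i j : I => i <= j)%N w.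
  have wu : perm_eq w u by rewrite perm_sym perm_sort.
  have [c e] := word_perm Aq_gen_qcomm wu; exists c; exists u; last exact: e.
  rewrite /normal_word sort_sorted /=; last by move=> i j; apply: leq_total.
  apply/forallP => i; rewrite (permP (permEl (perm_sort _ _))).
  exact: (forallP w1).
left; have [i] := forallPn w1; rewrite negb_imply -ltnNge => /andP[oi iw].
have i_w : i \in w by rewrite -has_pred1 has_count ltnW.
have i_w2 : i \in rem i w.
  rewrite -has_pred1 has_count; move: iw.
  by rewrite (permP (perm_to_rem i_w)) /= eqxx.
have ww : perm_eq w [:: i, i & rem i (rem i w)].
  by rewrite (permPl (perm_to_rem i_w)) perm_cons perm_to_rem.
have [c e] := word_perm Aq_gen_qcomm ww.
by rewrite e !big_cons mulrA -expr2 (Aq_gen_sqr oi) mul0r scaler0.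
Qed.

Lemma pi_free_eval (x : F) : pi x = free_eval a_ x.
Proof. by rewrite (free_eval_unique (quot2_pi (@Aq_ideal K q m n))). Qed.

(** The normal form is produced in the free algebra and not in its quotient,
    since coefficients of words only make sense there. *)
Lemma Aq_normal_form (x : F) : exists2 y : F, pi y = pi x &
  forall k, k \in msupp y -> normal_word k.
Proof.
pose P (z : Aq q m n) := exists2 y : F, pi y = z &
  forall k, k \in msupp y -> normal_word k.
have P0 : P 0 by exists 0; [exact: linear0 | move=> k; rewrite msupp0].
have PD z t : P z -> P t -> P (z + t).
  case=> y <- y_n [y' <- y'_n]; exists (y + y'); first exact: linearD.
  by move=> k /(fsubsetP (msuppD_le _ _)); rewrite in_fsetU => /orP[/y_n|/y'_n].
suff: P (pi x) by [].
rewrite pi_free_eval free_evalE; elim/big_ind: _ => // k _.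
have [->|[c [u u_n ->]]] := Aq_word_normal k; first by rewrite scaler0.
exists << x@_k * c *g FMonom u >>.
  by rewrite pi_free_eval free_evalU scalerA.
by move=> l /(fsubsetP msuppU_le); rewrite in_fset1 => /eqP ->.
Qed.

End Superspace.

(** * Morphisms out of quotients and inverse morphisms *)

Section QuotientLift.
Variables (K : comNzRingType) (A B : algType K) (J : ideal2 A).
Variable f : {lrmorphism A -> B}.

(** The proof that [f] kills [J] is an argument of the definition so that the
    linear and multiplicative structures can be attached to it. *)
Definition quot2_lift of (forall x, x \in J -> f x = 0) : quot2 J -> B :=
  fun z => f (repr z).

Hypothesis fJ : forall x, x \in J -> f x = 0.

Lemma quot2_lift_pi x : quot2_lift fJ (quot2_pi J x) = f x.
Proof.
have : repr (quot2_pi J x) - x \in J by apply/quot2_eq; rewrite reprK.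
by move/fJ/eqP; rewrite rmorphB subr_eq0 => /eqP.
Qed.

Fact quot2_lift_linear : linear (quot2_lift fJ).
Proof.
move=> c y z; have [x <-] := quot2_pi_surj y; have [t <-] := quot2_pi_surj z.
by rewrite -linearP !quot2_lift_pi linearP.
Qed.
HB.instance Definition _ := GRing.isLinear.Build K (quot2 J) B *:%R
  (quot2_lift fJ) quot2_lift_linear.

Fact quot2_lift_monoid_morphism : monoid_morphism (quot2_lift fJ).
Proof.
split=> [|y z]; first by rewrite -(rmorph1 (quot2_pi J)) quot2_lift_pi rmorph1.
have [x <-] := quot2_pi_surj y; have [t <-] := quot2_pi_surj z.
by rewrite -rmorphM !quot2_lift_pi rmorphM.
Qed.
HB.instance Definition _ := GRing.isMonoidMorphism.Build (quot2 J) B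
  (quot2_lift fJ) quot2_lift_monoid_morphism.
End QuotientLift.

Section InverseMorphism.
Variables (K : comNzRingType) (A B : algType K) (f : {lrmorphism A -> B}).
Variable g : B -> A.

(** A name for [g] that remembers the two cancellation proofs, from which its
    linearity and multiplicativity are inferred. *)
Definition inverse_morphism of cancel f g & cancel g f : B -> A := g.

Hypotheses (fK : cancel f g) (gK : cancel g f).
HB.instance Definition _ := GRing.isLinear.Build K B A *:%R
  (inverse_morphism fK gK) (can2_linear fK gK).
HB.instance Definition _ := GRing.isMonoidMorphism.Build B A
  (inverse_morphism fK gK) (can2_monoid_morphism fK gK).
End InverseMorphism.

Lemma bijective_lrmorphism (K : comNzRingType) (A B : algType K)
    (f : {lrmorphism A -> B}) :
  injective f -> (forall b, exists a, f a = b) ->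
  exists g : {lrmorphism B -> A}, cancel f g /\ cancel g f.
Proof.
move=> f_inj f_surj; have [g gK] := choice f_surj.
have fK : cancel f g by move=> a; apply: f_inj; rewrite gK.
by exists (inverse_morphism fK gK : {lrmorphism B -> A}).
Qed.

(** * The isomorphism *)

Section Isomorphism.
Variables (K : fieldType) (q : K) (q_neq0 : q != 0) (m n : nat).
Local Notation I := 'I_(m + n).
Local Notation F := (free_alg K I).
Local Notation d_ := (@Dq_gen K q m n).
Local Notation Aq := (Aq q m n).
Local Notation Dq := (Dq q m n).

Definition Dq_val (x : Dq) : End_Omega K m n := \val x.

Fact Dq_val_linear : linear Dq_val.
Proof. by []. Qed.
HB.instance Definition _ := GRing.isLinear.Build K Dq (End_Omega K m n) *:%R
  Dq_val Dq_val_linear.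

Fact Dq_val_monoid_morphism : monoid_morphism Dq_val.
Proof. by []. Qed.
HB.instance Definition _ := GRing.isMonoidMorphism.Build Dq (End_Omega K m n)
  Dq_val Dq_val_monoid_morphism.

Lemma Dq_val_inj : injective Dq_val.
Proof. exact: val_inj. Qed.

Lemma Dq_eval_ideal x : x \in @Aq_ideal K q m n -> free_eval d_ x = 0.
Proof.
have comm (i j : I) : (i < j)%N -> d_ j * d_ i = twist q i *: (d_ i * d_ j).
  by move=> ij; apply: Dq_val_inj; apply: (dq_comm q_neq0 ij).
have ev i j : free_eval d_ (free_gen K i * free_gen K j) = d_ i * d_ j.
  by rewrite rmorphM /= !free_eval_gen.
have evZD c x1 x2 d1 d2 : free_eval d_ x1 = d1 -> free_eval d_ x2 = d2 ->
    free_eval d_ (x1 + c *: x2) = d1 + c *: d2.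
  by move=> <- <-; rewrite linearD linearZ.
move=> /asboolP/(_ (fun y => free_eval d_ y = 0)); apply.
- exact: linear0.
- by move=> u v u0 v0; rewrite linearB /= u0 v0 subr0.
- by move=> a u u0; rewrite rmorphM /= u0 mulr0.
- by move=> a u u0; rewrite rmorphM /= u0 mul0r.
move=> _ [i j im ij|i im|i j im ij].
- rewrite -scaleNr (evZD _ _ _ _ _ (ev j i) (ev i j)) (comm _ _ ij).
  by rewrite /twist im scaleNr subrr.
- rewrite rmorphXn /= free_eval_gen; apply: Dq_val_inj.
  by rewrite rmorphXn linear0; apply: (dq_sqr q_neq0 im).
- rewrite (evZD _ _ _ _ _ (ev j i) (ev i j)) (comm _ _ ij).
  by rewrite /twist ltnNge im /= scaleNr addNr.
Qed.

Lemma Dq_eval_surj a : exists x : F, free_eval d_ x = a.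
Proof.
have /asboolP := valP a.
move=> /(_ (fun y => exists x : F, Dq_val (free_eval d_ x) = y)).
case=> [|c _ _ [x <-] [y <-]|_ _ [x <-] [y <-]|i|x /Dq_val_inj];
  last by exists x.
- by exists 1; rewrite !rmorph1.
- by exists (c *: x + y); rewrite !linearP.
- by exists (x * y); rewrite !rmorphM.
- by exists (free_gen K i); rewrite free_eval_gen.
Qed.

(** For odd letters the multiplicity is cut down to 0 or 1, which loses nothing
    on normal words. *)
Definition basis_of_word (w : seq I) : omega_basis m n :=
  ([ffun i => count_mem (lshift n i) w],
   [ffun i => (0 < count_mem (rshift m i) w)%N]).

Lemma deg_basis_of_word w : normal_word w ->
  forall i, deg (basis_of_word w) i = count_mem i w.
Proof.
move=> /andP[_ /forallP w1] i; rewrite /deg -[in RHS](splitK i).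
case: splitP (w1 i) => j ij; rewrite /= ffunE //.
rewrite /odd_index ij leq_addr /=.
have -> : i = rshift m j by apply: val_inj.
by case: (count_mem _ _) => [|[|]].
Qed.

(** For a word [k0] of [y], the operator of [y] applied to the basis element
    with the letters of [k0] has a constant term to which only [k0] contributes,
    since a normal word is determined by its letters. *)
Lemma Dq_eval_normal_inj (y : F) : (forall k, k \in msupp y -> normal_word k) ->
  free_eval d_ y = 0 -> y = 0.
Proof.
move=> y_n y0; apply: (iffLR (malgP _ _)) => k0; rewrite mcoeff0.
apply/eqP/contraT; rewrite mcoeff_neq0 => k0y.
pose b := basis_of_word k0.
pose pair (f : End_Omega K m n) :=
  mcoeff (vacuum m n) (endo_app f (omega_elt K b)).
have pairD f g : pair (f + g) = pair f + pair g by apply: mcoeffD.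
have pairZ c f : pair (c *: f) = c * pair f by apply: mcoeffZ.
have pair0 : pair 0 = 0 by apply: mcoeff0.
have := congr1 pair (congr1 Dq_val y0).
rewrite linear0 pair0 free_eval_comp free_evalE (big_morph _ pairD pair0).
rewrite (bigD1_seq k0) //= [X in _ + X]big1_seq ?addr0 => [|k /andP[kk0 ky]].
  rewrite pairZ => /eqP; rewrite mulf_eq0 mcoeff_eq0 k0y /=.
  have /eqP nz := iffRL (dq_word_pairing q_neq0 k0 b)
    (deg_basis_of_word (y_n _ k0y)).
  by move=> /eqP.
rewrite pairZ; apply/eqP; rewrite mulf_eq0; apply/orP; right.
apply: contraR kk0 => /(dq_word_pairing q_neq0) e.
apply/eqP/val_inj/(normal_word_inj (y_n _ ky) (y_n _ k0y)) => i.
by rewrite -e (deg_basis_of_word (y_n _ k0y)).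
Qed.

(** [x] is congruent to a combination [y] of normal words, and so has the same
    value as [y] under the evaluation. *)
Lemma Dq_eval_eq0 (x : F) : free_eval d_ x = 0 -> x \in @Aq_ideal K q m n.
Proof.
have [y yx y_n] := Aq_normal_form q_neq0 x.
have xy : x - y \in @Aq_ideal K q m n.
  by rewrite -quot2_pi_eq0 linearB /= yx subrr.
move=> x0; move: (Dq_eval_ideal xy); rewrite linearB /= x0 sub0r => /eqP.
rewrite oppr_eq0 => /eqP/(Dq_eval_normal_inj y_n) y0.
by move: xy; rewrite y0 subr0.
Qed.

Lemma Aq_Dq_iso :
  exists f : {lrmorphism Aq -> Dq}, exists h : {lrmorphism Dq -> Aq},
  [/\ cancel f h, cancel h f & forall i, f (@Aq_gen K q m n i) = d_ i].
Proof.
pose f : {lrmorphism Aq -> Dq} := quot2_lift Dq_eval_ideal.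
have f_pi x : f (quot2_pi _ x) = free_eval d_ x by apply: quot2_lift_pi.
have f_inj : injective f.
  apply: raddf_inj => a; have [x <-] := quot2_pi_surj a.
  by move/(etrans (esym (f_pi x)))/Dq_eval_eq0; rewrite -quot2_pi_eq0 => /eqP.
have f_surj d : exists a, f a = d.
  by have [x <-] := Dq_eval_surj d; exists (quot2_pi _ x).
have [h [fK hK]] := bijective_lrmorphism f_inj f_surj.
by exists f, h; split=> // i; rewrite f_pi free_eval_gen.
Qed.

End Isomorphism.

Theorem proposition7 (K : closedFieldType) (charK : [pchar K] =i pred0)
    (q : K) (q_neq0 : q != 0) (q_neq1 : q != 1) (m n : nat) :
  [/\ is_superalgebra (@Dq_part K q m n),
      is_superalgebra (@Aq_part K q m n)
    & superalgebra_iso (@Dq_part K q m n) (@Aq_part K q m n)].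
Proof.
have two_neq0 : 2%:R != 0 :> K by rewrite (iffLR (pcharf0P K) charK).
have [f [h [fK hK f_gen]]] := Aq_Dq_iso q_neq0 m n.
have h_gen i : h (Dq_gen q i) = Aq_gen q i by rewrite -f_gen fK.
split.
- apply: (generator_parity_superalgebra (iota := @Dq_val K q m n) two_neq0).
  + exact: Dq_val_inj.
  + exact: parity_op_invol.
  + by move=> i; apply: (parity_op_dq q_neq0).
  + exact: Dq_eval_surj.
- apply: (generator_parity_superalgebra (iota := @Dq_val K q m n \o f)
    two_neq0).
  + exact: inj_comp (@Dq_val_inj _ _ _ _) (can_inj fK).
  + exact: parity_op_invol.
  + by move=> i /=; rewrite f_gen; apply: (parity_op_dq q_neq0).
  + move=> a; have [x <-] := quot2_pi_surj a; exists x.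
    by rewrite pi_free_eval.
exists h; split; first by exists f.
move=> s d; split; first exact: generator_parity_morph.
by move/(generator_parity_morph f_gen); rewrite hK.
Qed.
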